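(* Let $(X,g)$ be a compact minimal system and let $h\in\tau[g]$. Then $h$ can be expressed in exactly one way in the form \[ h=g_{A_n}\cdots g_{A_2}g_{A_1}g^r \] with $n\ge 0$, $r\in\mathbb{Z}$, and $A_1,\dots,A_n$ nonempty clopen subsets of $X$ satisfying $A_n\subseteq\dots\subseteq A_2\subseteq A_1\subsetneq X$. Moreover, $h\in\tau_{\mathbb{N}}[g]$ if and only if $r\ge 0$ in this expression.
   Context: A homeomorphism $g$ of a Hausdorff space $X$ is minimal if $X\neq\emptyset$ and the only proper closed subset $K\subsetneq X$ with $gK\subseteq K$ is $K=\emptyset$. A compact minimal system $(X,g)$ is an infinite compact Hausdorff space $X$ with a minimal homeomorphism $g$ of $X$ (so $g$ is aperiodic). The topological full group $\tau[g]$ is the group of all homeomorphisms $h$ of $X$ for which there is a locally constant function $c:X\to\mathbb{Z}$ (unique, since $g$ is aperiodic) with $hx=g^{c(x)}x$ for all $x\in X$. An element $h\in\tau[g]$ is strongly positive if for every $y\in X$ with $hy\ne y$ we have $c(y)>0$; $\tau_{\mathbb{N}}[g]$ is the set of strongly positive elements of $\tau[g]$. For a nonempty clopen $A\subseteq X$, the induced transformation $g_A$ is the homeomorphism of $X$ with $g_Ax=g^tx$ for $x\in A$, where $t$ is the least positive integer such that $g^tx\in A$, and $g_Ax=x$ for $x\in X\smallsetminus A$. Products are compositions of maps, applied right to left. *)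

(* Defs.v *)
From mathcomp Require Import all_boot all_order all_algebra.
From mathcomp Require Import all_classical topology.

Set Implicit Arguments.
Unset Strict Implicit.
Unset Printing Implicit Defensive.

Import Order.TTheory GRing.Theory Num.Theory.

Local Open Scope classical_set_scope.
Local Open Scope ring_scope.

Record homeo (X : topologicalType) := Homeo {
  homeo_fun :> X -> X;
  homeo_inv : X -> X;
  homeo_funK : cancel homeo_fun homeo_inv;
  homeo_invK : cancel homeo_inv homeo_fun;
  homeo_fun_continuous : continuous homeo_fun;
  homeo_inv_continuous : continuous homeo_inv }.

Definition minimal_homeo (X : topologicalType) (g : homeo X) : Prop :=
  [set: X] !=set0 /\
  forall K : set X, closed K -> K `<` [set: X] -> g @` K `<=` K -> K = set0.

Definition compact_minimal_system (X : topologicalType) (g : homeo X) : Prop :=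
  [/\ infinite_set [set: X], compact [set: X], hausdorff_space X
    & minimal_homeo g].

Definition homeo_zpow (X : topologicalType) (g : homeo X) (r : int) : X -> X :=
  match r with
  | Posz n => iter n g
  | Negz n => iter n.+1 (homeo_inv g)
  end.

Definition locally_constant (X : topologicalType) (T : Type) (f : X -> T) :
  Prop := forall x : X, \forall y \near x, f y = f x.

Definition is_cocycle (X : topologicalType) (g h : homeo X) (c : X -> int) :
  Prop := locally_constant c /\ forall x : X, h x = homeo_zpow g (c x) x.

Definition topological_full_group (X : topologicalType) (g : homeo X) :
  set (homeo X) := [set h | exists c : X -> int, is_cocycle g h c].

(* The cocycle c of h is unique when g is aperiodic, so quantifying it
   existentially here amounts to speaking of the cocycle of h. *)
Definition strongly_positive (X : topologicalType) (g : homeo X) :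
  set (homeo X) :=
  [set h | exists c : X -> int,
     is_cocycle g h c /\ forall y : X, h y <> y -> 0 < c y].

(* For g minimal on a compact space and A nonempty clopen, every x in A returns
   to A; the default value 0 is only used outside of that situation. *)
Definition return_time (X : topologicalType) (g : homeo X) (A : set X) (x : X) :
  nat :=
  xget 0%N [set t : nat | [/\ (0 < t)%N, A (iter t g x)
    & forall s : nat, (0 < s)%N -> A (iter s g x) -> (t <= s)%N]].

Definition induced (X : topologicalType) (g : homeo X) (A : set X) (x : X) : X :=
  if x \in A then iter (return_time g A x) g x else x.

(* The list [:: A_1; ...; A_n] and r give g_{A_n} \o ... \o g_{A_1} \o g^r. *)
Definition induced_product (X : topologicalType) (g : homeo X)
    (s : seq (set X)) (r : int) : X -> X :=
  foldl (fun f A => induced g A \o f) (homeo_zpow g r) s.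

(* nth is 0-based: nth set0 s i is the set A_(i+1). *)
Definition is_clopen_chain (X : topologicalType) (s : seq (set X)) : Prop :=
  [/\ forall i : nat, (i < size s)%N -> clopen (nth set0 s i),
      forall i : nat, (i < size s)%N -> nth set0 s i !=set0,
      forall i : nat, (i.+1 < size s)%N -> nth set0 s i.+1 `<=` nth set0 s i
    & (0 < size s)%N -> nth set0 s 0 `<` [set: X]].

Definition is_decomposition (X : topologicalType) (g h : homeo X)
    (d : seq (set X) * int) : Prop :=
  is_clopen_chain d.1 /\ homeo_fun h = induced_product g d.1 d.2.

(* Main.v *)
(* Let c be the cocycle of h. At a point outside A_1 the product of induced maps
   is the identity, and elsewhere it moves points forward, so r must be the
   minimum of c. Replacing h by h g^{-r}, the cocycle becomes nonnegative with a
   zero, and A_1 must be the support {c > 0}. On that support h is a bijection,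
   so c dominates the return time to A_1, and h g_{A_1}^{-1} again has a
   nonnegative cocycle, supported in A_1 and with strictly smaller maximum. *)

Require Import Defs.
From mathcomp Require Import all_boot all_order all_algebra.
From mathcomp Require Import all_classical topology.
From mathcomp Require Import zify.

Set Implicit Arguments.
Unset Strict Implicit.
Unset Printing Implicit Defensive.

Import Order.TTheory GRing.Theory Num.Theory.

Local Open Scope classical_set_scope.
Local Open Scope ring_scope.

(** * Inverses and integer powers of a homeomorphism *)

Definition homeo_sym (X : topologicalType) (g : homeo X) : homeo X :=
  @Homeo X (homeo_inv g) g (homeo_invK g) (homeo_funK g)
    (@homeo_inv_continuous X g) (@homeo_fun_continuous X g).

Lemma homeo_symK (X : topologicalType) (g : homeo X) :
  homeo_sym (homeo_sym g) = g.
Proof. by case: g. Qed.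

Lemma iter_homeo_sym (X : topologicalType) (g : homeo X) (s t : nat) (x : X) :
  (s <= t)%N -> iter s (homeo_sym g) (iter t g x) = iter (t - s) g x.
Proof.
move=> st; rewrite -{1}(subnKC st) iterD; elim: s {st} (iter _ g x) => //= s IH y.
by rewrite -iterS iterSr /= homeo_funK.
Qed.

Lemma homeo_zpow1D (X : topologicalType) (g : homeo X) (a : int) (x : X) :
  homeo_zpow g (1 + a) x = g (homeo_zpow g a x).
Proof.
by case: a => [n|[|n]] //=; rewrite homeo_invK // subn1.
Qed.

Lemma homeo_zpowD (X : topologicalType) (g : homeo X) (a b : int) (x : X) :
  homeo_zpow g (a + b) x = homeo_zpow g a (homeo_zpow g b x).
Proof.
have zpowB1 c y : homeo_zpow g (c - 1) y = homeo_inv g (homeo_zpow g c y).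
  by rewrite -[in RHS](subrKC 1 c) homeo_zpow1D homeo_funK.
elim/int_rect: a => [|n IH|n IH]; first by rewrite add0r.
- by rewrite intS -addrA !homeo_zpow1D IH.
have -> : - n.+1%:Z = - n%:Z - 1 by lia.
by rewrite addrAC !zpowB1 IH.
Qed.

Lemma homeo_zpowK (X : topologicalType) (g : homeo X) (r : int) :
  cancel (homeo_zpow g r) (homeo_zpow g (- r)).
Proof. by move=> x; rewrite -homeo_zpowD addNr. Qed.

Lemma homeo_zpow_continuous (X : topologicalType) (g : homeo X) (r : int) :
  continuous (homeo_zpow g r).
Proof.
have iterC (f : X -> X) n : continuous f -> continuous (iter n f).
  move=> cf; elim: n => [|n IH] x; first exact: cvg_id.
  exact: (continuous_comp (IH x) (cf _)).
by case: r => n; apply: iterC;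
  [apply: homeo_fun_continuous | apply: homeo_inv_continuous].
Qed.

(** * Locally constant functions, clopen sets and compactness *)

Lemma locally_constant_comp (X : topologicalType) (T : Type) (c : X -> T)
    (f : X -> X) :
  locally_constant c -> continuous f -> locally_constant (c \o f).
Proof. by move=> lc cf x; apply: (cf x _ (lc (f x))). Qed.

Lemma locally_constant_clopen (X : topologicalType) (T : Type) (c : X -> T)
    (P : set T) : locally_constant c -> clopen (c @^-1` P).
Proof.
move=> lc; have op Q : open (c @^-1` Q).
  rewrite openE => x Qx; apply: filterS (lc x) => y /= cyx.
  by rewrite /preimage /= cyx.
by split=> //; have /open_closedC := op (~` P); rewrite -preimage_setC setCK.
Qed.

(** Here [A] is read as a [Prop]-valued function, so that membership can be composed with powers of
    [g] like a cocycle. *)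
Lemma clopen_locally_constant (X : topologicalType) (A : set X) :
  clopen A -> locally_constant A.
Proof.
move=> [oA cA] x; have [Ax|nAx] := pselect (A x).
  apply: filterS (open_nbhs_nbhs (conj oA Ax)) => y Ay.
  by apply/propext; split.
apply: filterS (open_nbhs_nbhs (conj (closed_openC cA) nAx)) => y nAy.
by apply/propext; split.
Qed.

(** Compactness in near-covering form turns local bounds into one global bound. It serves for
    cocycles and for hitting times. *)
Lemma compact_uniform_bound (X : topologicalType) (P : nat -> set X) :
  compact [set: X] ->
  (forall m n, (m <= n)%N -> P m `<=` P n) ->
  (forall x : X, exists n, nbhs x (P n)) ->
  exists n, forall x, P n x.
Proof.
move=> /compact_near_coveringP cX Pmono Pnear.
have : \forall n \near \oo, [set: X] `<=` P n.
  apply: cX => x _; have [n Pn] := Pnear x.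
  exists (P n, [set m | (n <= m)%N]) => /=.
    by split=> //; exact: nbhs_infty_ge.
  by move=> [y m] /= [Pny nm]; exact: Pmono nm _ Pny.
by move=> /filter_ex [n Pn]; exists n => x; exact: Pn.
Qed.

Lemma locally_constant_bounded (X : topologicalType) (c : X -> int) :
  compact [set: X] -> locally_constant c ->
  exists N : nat, forall x, (absz (c x) <= N)%N.
Proof.
move=> cX lc.
apply: (compact_uniform_bound (P := fun n x => (absz (c x) <= n)%N)) => //.
  by move=> m n mn x /= cm; exact: leq_trans mn.
by move=> x; exists (absz (c x)); apply: filterS (lc x) => y ->.
Qed.

(** * Aperiodicity and recurrence of minimal homeomorphisms *)

(** A periodic orbit would be finite, hence closed, and forward invariant; it is proper because [X]
    is infinite, so minimality would make it empty. *)
Lemma minimal_iter_neq (X : topologicalType) (g : homeo X) (n : nat) (x : X) :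
  compact_minimal_system g -> (0 < n)%N -> iter n g x <> x.
Proof.
move=> [infX _ hX [_ minX]] n0 gnx.
pose K := [set iter i g x | i in `I_n].
have Kfin : finite_set K by apply: finite_image; exact: finite_II.
have Kcl : closed K.
  exact: (accessible_finite_set_closed.1 (hausdorff_accessible hX)).
have KT : K <> [set: X] by move=> KT; apply: infX; rewrite -KT.
have /(minX K Kcl) K0 : K `<` [set: X] by rewrite properEneq; split=> //; apply/eqP.
have : K x by exists 0%N.
rewrite K0 //.
move=> y [_ [i /= ilt <-] <-]; have [iltn|ni] := ltnP i.+1 n.
  by exists i.+1.
by exists 0%N => //=; rewrite -iterS (_ : i.+1 = n) ?gnx //; apply/eqP; rewrite eqn_leq ilt.
Qed.

Lemma minimal_zpow_inj (X : topologicalType) (g : homeo X) (x : X) :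
  compact_minimal_system g -> injective (fun a => homeo_zpow g a x).
Proof.
move=> hg; have neq a b : a < b -> homeo_zpow g a x <> homeo_zpow g b x.
  move=> ab E; apply: (@minimal_iter_neq _ g (absz (b - a)) x hg); first by lia.
  have -> : iter (absz (b - a)) g x = homeo_zpow g (- a + b) x.
    by rewrite -[iter _ g x]/(homeo_zpow g (absz (b - a)) x); congr homeo_zpow; lia.
  by rewrite homeo_zpowD -E homeo_zpowK.
by move=> a b E; case: (ltgtP a b) => // /neq; rewrite E.
Qed.

Definition recurrent (X : topologicalType) (g : homeo X) (A : set X) : Prop :=
  forall x, exists2 n : nat, (0 < n)%N & A (iter n g x).

(** The points whose forward orbit avoids [A] form a proper closed forward invariant set, which is
    therefore empty. Backward recurrence is derived from a uniform bound on forward hitting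
    times. *)
Lemma minimal_recurrent (X : topologicalType) (g : homeo X) (A : set X) :
  compact_minimal_system g -> open A -> A !=set0 ->
  recurrent g A /\ recurrent (homeo_sym g) A.
Proof.
move=> [_ cX _ [_ minX]] oA [a Aa].
have opn n : open (iter n g @^-1` A).
  by apply: open_comp => // x _; exact: (@homeo_zpow_continuous _ g n).
pose U := \bigcup_n (iter n g @^-1` A).
have UT x : U x.
  apply: contrapT => nUx.
  suff K0 : ~` U = set0 by have : (~` U) x by []; rewrite K0.
  apply: minX.
  - by apply: open_closedC; apply: bigcup_open => n _; exact: opn.
  - by rewrite properEneq; split=> //; apply/eqP => /seteqP[_ /(_ a I)]; apply; exists 0%N.
  - by move=> _ [y nUy <-] [n _ Any]; apply: nUy; exists n.+1; rewrite // /preimage /= -iterS iterSr.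
have [N hN] : exists N, forall x, exists2 i, (i <= N)%N & A (iter i g x).
  apply: (@compact_uniform_bound _ (fun N x => exists2 i, (i <= N)%N & A (iter i g x))) => //.
    by move=> m n mn x [i im Ai]; exists i => //; exact: leq_trans mn.
  move=> x; have [n _ An] := UT x; exists n.
  by apply: filterS (open_nbhs_nbhs (conj (opn n) An)) => y Ay; exists n.
split=> x.
  by have [i _ Ai] := hN (g x); exists i.+1; rewrite // iterSr.
(* Start [N.+1] steps before [x]: the hit after [i <= N] steps happens [N.+1 - i > 0] steps before
   [x]. *)
have [i iN] := hN (iter N.+1 (homeo_sym g) x).
rewrite -{1}(homeo_symK g) iter_homeo_sym; last exact: leqW.
by exists (N.+1 - i)%N => //; rewrite subn_gt0 ltnS.
Qed.

(** * Return times and induced transformations *)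

Definition is_return_time (X : topologicalType) (g : homeo X) (A : set X) (x : X) :
    set nat :=
  [set t | [/\ (0 < t)%N, A (iter t g x)
    & forall s, (0 < s)%N -> A (iter s g x) -> (t <= s)%N]].

(** Recurrence makes the set of candidates inhabited, so the default value of [xget] is never
    taken. *)
Lemma return_timeP (X : topologicalType) (g : homeo X) (A : set X) (x : X) :
  recurrent g A -> is_return_time g A x (return_time g A x).
Proof.
move=> /(_ x) [n n0 An]; rewrite /return_time -/(is_return_time g A x).
have ex : exists m, (0 < m)%N && `[< A (iter m g x) >].
  by exists n; rewrite n0; apply/asboolP.
case: xgetP => // none; case: (none (ex_minn ex)).
case: ex_minnP => m /andP[m0 /asboolP Am] mmin; split=> // s s0 As.
by apply: mmin; rewrite s0; apply/asboolP.
Qed.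

Lemma return_timeE (X : topologicalType) (g : homeo X) (A : set X) (x : X) t :
  recurrent g A -> is_return_time g A x t -> return_time g A x = t.
Proof.
move=> rA [t0 At tmin]; have [u0 Au umin] := return_timeP x rA.
by apply/eqP; rewrite eqn_leq umin // tmin.
Qed.

Lemma return_time_locally_constant (X : topologicalType) (g : homeo X)
    (A : set X) :
  clopen A -> recurrent g A -> locally_constant (return_time g A).
Proof.
move=> clA rA x; set t := return_time g A x.
(* Only the visits to [A] up to time [t] decide the return time: finitely many locally constant
   conditions. *)
have : \forall y \near x, forall s : 'I_t.+1, A (iter s g y) = A (iter s g x).
  apply: filter_forall => s.
  exact: (locally_constant_comp (clopen_locally_constant clA)
    (@homeo_zpow_continuous _ g s)).
apply: filterS => y yA; apply: return_timeE => //.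
have [t0 At tmin] := return_timeP x rA.
split=> //; first by rewrite (yA ord_max).
move=> s s0 As; rewrite leqNgt; apply/negP => st.
have sb : (s < t.+1)%N by exact: ltnW.
have := tmin s s0; rewrite leqNgt st -(yA (Ordinal sb)).
by move=> /(_ As).
Qed.

Lemma induced_out (X : topologicalType) (g : homeo X) (A : set X) (x : X) :
  ~ A x -> induced g A x = x.
Proof. by move=> nAx; rewrite /induced memNset. Qed.

Lemma induced_in (X : topologicalType) (g : homeo X) (A : set X) (x : X) :
  A x -> induced g A x = iter (return_time g A x) g x.
Proof. by move=> Ax; rewrite /induced mem_set. Qed.

(** The backward return time at the image of [x] equals the forward return time [t] at [x]: a
    backward visit at time [s < t] would be a forward visit at time [t - s < t]. *)
Lemma inducedK (X : topologicalType) (g : homeo X) (A : set X) :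
  recurrent g A -> recurrent (homeo_sym g) A ->
  cancel (induced g A) (induced (homeo_sym g) A).
Proof.
move=> rA rA' x; have [Ax|nAx] := pselect (A x); last by rewrite !induced_out.
rewrite (induced_in _ Ax); set t := return_time g A x.
have [t0 At tmin] := return_timeP x rA.
rewrite (induced_in _ At) (@return_timeE _ _ _ _ t) //; last split=> //.
- by rewrite iter_homeo_sym // subnn.
- by rewrite iter_homeo_sym // subnn.
move=> s s0 As; rewrite leqNgt; apply/negP => st.
move: As; rewrite iter_homeo_sym; last exact: ltnW.
by move=> /tmin; rewrite subn_gt0 => /(_ st); rewrite -/t; lia.
Qed.

Lemma inducedVK (X : topologicalType) (g : homeo X) (A : set X) :
  recurrent g A -> recurrent (homeo_sym g) A ->
  cancel (induced (homeo_sym g) A) (induced g A).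
Proof.
by move=> rA rA'; rewrite -{2}(homeo_symK g); apply: inducedK => //; rewrite homeo_symK.
Qed.

Lemma induced_continuous (X : topologicalType) (g : homeo X) (A : set X) :
  clopen A -> recurrent g A -> continuous (induced g A).
Proof.
move=> clA rA x.
(* With this locally constant exponent, the induced map agrees near [x] with one fixed power of
   [g]. *)
pose k y := if y \in A then return_time g A y else 0%N.
have iE y : induced g A y = iter (k y) g y by rewrite /induced /k; case: ifP.
rewrite /continuous_at iE; apply: cvg_trans (@homeo_zpow_continuous _ g (k x) x).
apply: near_eq_cvg.
have := return_time_locally_constant clA rA x.
apply: filterS2 (clopen_locally_constant clA x) => y Ayx tyx.
by rewrite iE /k tyx /in_mem /= /in_set Ayx.
Qed.

(** * Nested chains and products of induced maps *)

(** Recursive form of the chain condition; the outer bound [B] lets an induction remove the largest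
    set and continue inside it. *)
Fixpoint nested (X : topologicalType) (B : set X) (s : seq (set X)) : Prop :=
  if s is A :: s' then [/\ clopen A, A !=set0, A `<=` B & nested A s'] else True.

Lemma nestedP (X : topologicalType) (B : set X) (s : seq (set X)) :
  nested B s <->
  [/\ forall i, (i < size s)%N -> clopen (nth set0 s i),
      forall i, (i < size s)%N -> nth set0 s i !=set0,
      forall i, (i.+1 < size s)%N -> nth set0 s i.+1 `<=` nth set0 s i
    & (0 < size s)%N -> nth set0 s 0 `<=` B].
Proof.
elim: s B => [|A s IH] B /=; first by split.
split=> [[clA A0 AB /IH [s1 s2 s3 s4]]|[s1 s2 s3 s4]].
  by split=> [[|i]|[|i]|[|i]|] //=; [exact: s1|exact: s2|exact: s3].
split; [exact: s1 0%N _|exact: s2 0%N _|exact: s4|].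
apply/IH; split=> [i|i|i|]; [exact: s1 i.+1|exact: s2 i.+1|exact: s3 i.+1|exact: s3 0%N].
Qed.

Lemma nested_sub (X : topologicalType) (B C : set X) (s : seq (set X)) :
  B `<=` C -> nested B s -> nested C s.
Proof.
by case: s => //= A s BC [clA A0 AB ns]; split=> //; exact: subset_trans BC.
Qed.

(** Only the value of the accumulator at the point matters, so the innermost factor can be moved
    into the argument. *)
Lemma eq_foldl_induced (X : topologicalType) (g : homeo X) (s : seq (set X))
    (f f' : X -> X) (x y : X) :
  f x = f' y ->
  foldl (fun f A => induced g A \o f) f s x =
  foldl (fun f A => induced g A \o f) f' s y.
Proof. by elim: s f f' => //= A s IH f f' fE; apply: IH; rewrite /= fE. Qed.

Lemma induced_product_zpow (X : topologicalType) (g : homeo X)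
    (s : seq (set X)) (r : int) (x : X) :
  induced_product g s r x = induced_product g s 0 (homeo_zpow g r x).
Proof. exact: (@eq_foldl_induced _ _ s). Qed.

Lemma induced_product_cons (X : topologicalType) (g : homeo X)
    (A : set X) (s : seq (set X)) (x : X) :
  induced_product g (A :: s) 0 x = induced_product g s 0 (induced g A x).
Proof. exact: (@eq_foldl_induced _ _ s). Qed.

(** * Existence for nonnegative cocycles *)

(** Induction on the bound [N]: the support [A] of [c] is the first set, and composing [f] on the
    right with the inverse of the induced map lowers the bound by one. *)
Lemma nonneg_decomposition (X : topologicalType) (g : homeo X) (N : nat)
    (f : X -> X) (c : X -> nat) :
  compact_minimal_system g -> locally_constant c -> injective f ->
  (forall x, f x = iter (c x) g x) -> (forall x, (c x <= N)%N) ->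
  exists2 s, nested [set x | (0 < c x)%N] s & f =1 induced_product g s 0.
Proof.
move=> hg; elim: N f c => [|N IH] f c lc finj fE cN.
  by exists [::] => // x; rewrite fE; have := cN x; rewrite leqn0 => /eqP ->.
pose A := [set x | (0 < c x)%N].
have clA : clopen A := locally_constant_clopen [set n | (0 < n)%N] lc.
have c0 x : ~ A x -> c x = 0%N by move=> /negP; rewrite -eqn0Ngt => /eqP.
have [A0|nA] := pselect (A !=set0); last first.
  exists [::] => // x; rewrite fE c0 // => Ax; apply: nA; by exists x.
have [rA rA'] := minimal_recurrent hg clA.1 A0.
(* If [f x] left the support, it would be fixed by [f]; injectivity would give [f x = x], against
   aperiodicity. *)
have fA x : A x -> A (f x).
  move=> Ax; apply: contrapT => /c0 cfx0.
  have /finj fx : f (f x) = f x by rewrite fE cfx0.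
  by apply: (@minimal_iter_neq _ g (c x) x hg Ax); rewrite -fE.
pose t := return_time g A.
have tc x : A x -> (t x <= c x)%N.
  move=> Ax; have [_ _ tmin] := return_timeP x rA.
  by apply: tmin => //; rewrite -fE; exact: fA.
(* On [A] the subtraction is exact by [tc]; off [A] truncation gives 0, the right value there. *)
pose d x := (c x - t x)%N.
have dE x : f x = iter (d x) g (induced g A x).
  have [Ax|nAx] := pselect (A x).
    by rewrite (induced_in _ Ax) -iterD subnK ?fE //; exact: tc.
  by rewrite induced_out // fE /d c0.
pose q := induced (homeo_sym g) A.
have qK : cancel q (induced g A) := inducedVK rA rA'.
have Kq : cancel (induced g A) q := inducedK rA rA'.
have [||x|x|s ns fs] := IH (f \o q) (d \o q).
- apply: locally_constant_comp; last first.
    by apply: induced_continuous; rewrite ?homeo_symK.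
  move=> x; apply: filterS2 (lc x) (return_time_locally_constant clA rA x).
  by move=> y cy ty; rewrite /d /t cy ty.
- exact: (inj_comp finj (can_inj qK)).
- by rewrite /= dE qK.
- rewrite /=; have [Ax|nAx] := pselect (A (q x)); last by rewrite /d c0.
  have [t0 _ _] := return_timeP (q x) rA.
  (* The bound drops from [N.+1] to [N] because return times are at least 1. *)
  by rewrite leq_subLR; apply: leq_trans (cN _) _; rewrite -add1n leq_add2r.
exists (A :: s).
  (* The new support lies in [A]: if [d (q x) > 0], then [q x] is in [A], and so is its image [x]
     under the induced map. *)
  split=> //; apply: nested_sub ns => x /= dqx.
  have Aqx : A (q x) by exact: leq_trans dqx (leq_subr _ _).
  rewrite -[x]qK (induced_in _ Aqx).
  by have [] := return_timeP (q x) rA.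
by move=> x; rewrite induced_product_cons -fs /= Kq.
Qed.

(** * Recovering the chain from its product *)

Lemma nested_product_out (X : topologicalType) (g : homeo X) (B : set X)
    (s : seq (set X)) (x : X) :
  nested B s -> ~ B x -> induced_product g s 0 x = x.
Proof.
elim: s B => //= A s IH B [_ _ AB ns] nBx.
have nAx : ~ A x by move=> /AB.
by rewrite induced_product_cons induced_out //; exact: IH ns nAx.
Qed.

(** No factor moves a point backward, so the strict advance made by the first factor on its set
    cannot be undone. *)
Lemma nested_product_iter (X : topologicalType) (g : homeo X) (B : set X)
    (s : seq (set X)) (x : X) :
  compact_minimal_system g -> nested B s ->
  exists2 n, induced_product g s 0 x = iter n g x
           & (0 < size s)%N -> nth set0 s 0 x -> (0 < n)%N.
Proof.
move=> hg; elim: s B x => [|A s IH] B x /=; first by exists 0%N.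
move=> [clA A0 _ ns]; have [rA _] := minimal_recurrent hg clA.1 A0.
rewrite induced_product_cons.
have [Ax|nAx] := pselect (A x).
  have [n -> _] := IH A (induced g A x) ns.
  have [t0 _ _] := return_timeP x rA.
  exists (n + return_time g A x)%N; first by rewrite iterD induced_in.
  by rewrite addn_gt0 t0 orbT.
by have [n En _] := IH A x ns; exists n => //; rewrite induced_out.
Qed.

(** This identifies the largest set of a chain as the set of points moved by the product, hence as
    determined by the product. *)
Lemma nested_product_moved (X : topologicalType) (g : homeo X) (A B : set X)
    (s : seq (set X)) (x : X) :
  compact_minimal_system g -> nested B (A :: s) ->
  A x <-> induced_product g (A :: s) 0 x <> x.
Proof.
move=> hg ns; split=> [Ax|]; last first.
  move=> mv; apply: contrapT => nAx; apply: mv; move: ns => /= [_ _ _ ns].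
  by rewrite induced_product_cons induced_out // (nested_product_out _ ns nAx).
have [n -> n0] := nested_product_iter x hg ns.
by apply: minimal_iter_neq => //; exact: n0.
Qed.

Lemma nested_product_inj (X : topologicalType) (g : homeo X) (B B' : set X)
    (s s' : seq (set X)) :
  compact_minimal_system g -> nested B s -> nested B' s' ->
  induced_product g s 0 =1 induced_product g s' 0 -> s = s'.
Proof.
move=> hg; elim: s s' B B' => [|A s IH] [|A' s'] B B' // ns ns' E.
- have [_ [x /(nested_product_moved _ hg ns') mv] _ _] := ns'.
  by case: mv; rewrite -E.
- have [_ [x /(nested_product_moved _ hg ns) mv] _ _] := ns.
  by case: mv; rewrite E.
have AA' : A = A'.
  apply/seteqP; split=> x.
    by move=> /(nested_product_moved _ hg ns); rewrite E => /(nested_product_moved _ hg ns').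
  by move=> /(nested_product_moved _ hg ns'); rewrite -E => /(nested_product_moved _ hg ns).
subst A'; case: ns ns' => clA A0 _ ns [_ _ _ ns'].
have [rA rA'] := minimal_recurrent hg clA.1 A0.
congr cons; apply: (IH _ A A) => // x.
(* Cancel the common first factor by evaluating at the preimage of [x]. *)
by have := E (induced (homeo_sym g) A x); rewrite !induced_product_cons inducedVK.
Qed.

(** * Decompositions of an element of the full group *)

Lemma chain_nested (X : topologicalType) (s : seq (set X)) :
  is_clopen_chain s -> nested [set: X] s.
Proof. by move=> [s1 s2 s3 s4]; apply/nestedP; split. Qed.

(** A point outside the largest set, which is proper, is outside all the others; for the empty chain
    any point serves. *)
Lemma chain_fixed_point (X : topologicalType) (g : homeo X) (s : seq (set X)) :
  compact_minimal_system g -> is_clopen_chain s ->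
  exists x, induced_product g s 0 x = x.
Proof.
move=> [_ _ _ [[x0 _] _]]; case: s => [|A s] ch; first by exists x0.
have [_ _ _ /(_ isT) /= [_ nTA]] := ch.
have [x nAx] : exists x, ~ A x by apply/existsNP => h; apply: nTA => x _.
exists x; have [_ _ _ ns] := chain_nested ch.
by rewrite induced_product_cons induced_out //; exact: nested_product_out ns nAx.
Qed.

(** Together the two conclusions characterize [r] as the least exponent occurring in [h]; uniqueness
    and the sign criterion both rest on this. *)
Lemma decomposition_exponent (X : topologicalType) (g h : homeo X)
    (s : seq (set X)) (r : int) :
  compact_minimal_system g -> is_decomposition g h (s, r) ->
  (forall x, exists n : nat, h x = homeo_zpow g (n%:Z + r) x) /\
  exists x, h x = homeo_zpow g r x.
Proof.
move=> hg [/= ch hE]; split=> [x|].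
  have [n En _] := nested_product_iter (homeo_zpow g r x) hg (chain_nested ch).
  by exists n; rewrite hE induced_product_zpow En homeo_zpowD.
have [x fx] := chain_fixed_point hg ch.
exists (homeo_zpow g (- r) x).
by rewrite hE induced_product_zpow -homeo_zpowD subrr.
Qed.

Lemma decomposition_unique (X : topologicalType) (g h : homeo X)
    (d d' : seq (set X) * int) :
  compact_minimal_system g -> is_decomposition g h d ->
  is_decomposition g h d' -> d = d'.
Proof.
case: d d' => [s r] [s' r'] hg hd hd'.
have le s1 r1 s2 r2 : is_decomposition g h (s1, r1) ->
    is_decomposition g h (s2, r2) -> r2 <= r1.
  move=> h1 h2; have [_ [x hx]] := decomposition_exponent hg h1.
  have [/(_ x) [n]] := decomposition_exponent hg h2.
  by rewrite hx => /(minimal_zpow_inj hg) ->; rewrite lerDr.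
have Er : r = r' by apply/eqP; rewrite eq_le (le _ _ _ _ hd hd') (le _ _ _ _ hd' hd).
subst r'; case: hd hd' => /= ch hE [/= ch' hE'].
congr pair; apply: (nested_product_inj hg (chain_nested ch) (chain_nested ch')) => x.
rewrite -[x](homeo_zpowK g (- r)) opprK -!induced_product_zpow.
by rewrite -hE -hE'.
Qed.

Lemma decomposition_exists (X : topologicalType) (g h : homeo X) :
  compact_minimal_system g -> topological_full_group g h ->
  exists d, is_decomposition g h d.
Proof.
move=> hg [c [lc hE]]; have [_ cX _ [[x0 _] _]] := hg.
have [N cN] := locally_constant_bounded cX lc.
(* Adding the bound [N] makes the cocycle nonnegative, so its minimum [r] is found among natural
   numbers. *)
have ex : exists n, `[< exists x, absz (c x + N%:Z) = n >].
  by exists (absz (c x0 + N%:Z)); apply/asboolP; exists x0.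
have [r [[xr cxr] rmin]] : exists r, (exists x, c x = r) /\ forall x, r <= c x.
  case: (ex_minnP ex) => m /asboolP [x xm] mmin.
  exists (c x); split; first by exists x.
  move=> y.
  have /mmin : `[< exists x, absz (c x + N%:Z) = absz (c y + N%:Z) >].
    by apply/asboolP; exists y.
  by rewrite -xm; have := cN x; have := cN y; lia.
pose p := homeo_zpow g (- r).
have [|x y|x|x|s ns fs] := @nonneg_decomposition _ g (N + absz r) (h \o p)
  (fun x => absz (c (p x) - r)) hg.
- have := locally_constant_comp lc (@homeo_zpow_continuous _ g (- r)).
  by move=> lcp x; apply: filterS (lcp x) => y /= ->.
- move=> /(can_inj (homeo_funK h)) pxy.
  by apply: (can_inj (homeo_zpowK g (- r))).
- rewrite /= hE -[RHS]/(homeo_zpow g (absz (c (p x) - r)) x) -homeo_zpowD.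
  by congr homeo_zpow; have := rmin (p x); lia.
- by have := cN (p x); lia.
exists (s, r); split=> /=; last first.
  apply/funext => x; rewrite induced_product_zpow -fs /= /p.
  by rewrite homeo_zpowK.
have /nestedP [s1 s2 s3 s4] := ns; split=> // /s4 sA.
(* The first set is proper: it misses the image under the power [r] of the point [xr] where the
   minimum is attained. *)
split=> // /(_ (homeo_zpow g r xr) I)/sA /=.
by rewrite /p homeo_zpowK cxr subrr.
Qed.

(** At a point with exponent exactly [r], either [h] fixes it and [r = 0], or strong positivity
    gives [r > 0]. Conversely all exponents are at least [r], and they are nonzero at moved
    points. *)
Lemma strongly_positive_iff (X : topologicalType) (g h : homeo X)
    (s : seq (set X)) (r : int) :
  compact_minimal_system g -> topological_full_group g h ->
  is_decomposition g h (s, r) -> (strongly_positive g h <-> 0 <= r).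
Proof.
move=> hg [c ch] hd; have [hn [x hx]] := decomposition_exponent hg hd.
split=> [[c' [[_ c'E] c'pos]]|r0].
  have [hxx|/c'pos] := pselect (h x = x).
    suff -> : r = 0 by [].
    by apply: (@minimal_zpow_inj _ g x hg); rewrite /= -hx hxx.
  have -> : c' x = r by apply: (@minimal_zpow_inj _ g x hg); rewrite /= -c'E.
  exact: ltW.
exists c; split=> // y hy; have [n hny] := hn y.
have cy : c y = n%:Z + r by apply: (@minimal_zpow_inj _ g y hg); rewrite /= -ch.2.
have : c y != 0 by apply/eqP => cy0; apply: hy; rewrite ch.2 cy0.
by lia.
Qed.

Theorem theorem1p8 (X : topologicalType) (g h : homeo X)
    (hg : compact_minimal_system g) (hh : topological_full_group g h) :
  (exists! d : seq (set X) * int, is_decomposition g h d) /\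
  (forall (s : seq (set X)) (r : int),
     is_decomposition g h (s, r) -> (strongly_positive g h <-> 0 <= r)).
Proof.
split=> [|s r]; last exact: strongly_positive_iff.
have [d hd] := decomposition_exists hg hh.
by exists d; split=> // d'; exact: decomposition_unique.
Qed.
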